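(* Let $|\Psi_a\rangle=\sqrt a\,|00\rangle+\sqrt{1-a}\,|11\rangle$ with $\frac12<a<1$, a non-maximally entangled two-qubit pure state with concurrence $C(|\Psi_a\rangle)=2\sqrt{a(1-a)}\in(0,1)$. Let $\mathcal U_a$ be the set of unital qubit channels $\Lambda_u$ for which the final shared state $(\mathbf I\otimes\Lambda_u)(|\Psi_a\rangle\langle\Psi_a|)$, obtained by sending one half of $|\Psi_a\rangle$ through $\Lambda_u$, is useful for universal quantum teleportation (UQT). Then $\mathcal U_a$ is a nonempty strict subset of the set of all unital qubit channels if and only if $\frac12<C(|\Psi_a\rangle)<1$. (In particular, if $C(|\Psi_a\rangle)\le\frac12$, there is no unital qubit channel for which the final state is useful for UQT.)
   Context: A qubit channel is a completely positive trace-preserving linear map $\Lambda$ on $2\times2$ complex matrices; it is unital if $\Lambda(\mathbf I_2)=\mathbf I_2$. If Alice prepares a two-qubit state $\rho$ and sends one half (the second qubit) through $\Lambda$, the final shared state is $(\mathbf I\otimes\Lambda)(\rho)$. Useful for UQT. For a two-qubit density matrix $\rho$ let $T_\rho$ be the real $3\times3$ matrix with entries $T_{ij}=\mathrm{Tr}(\rho\,\sigma_i\otimes\sigma_j)$ ($\sigma_1,\sigma_2,\sigma_3$ the Pauli matrices). By local unitaries $\rho$ can be brought to a canonical form $\rho_C$ with diagonal correlation matrix $\mathrm{diag}(\tau_1,\tau_2,\tau_3)$, $\tau_k=\lambda_k|t_{kk}|$, $\lambda_k\in\{\pm1\}$, where $|t_{11}|,|t_{22}|,|t_{33}|$ are the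 singular values of $T_\rho$; if $\det T_\rho\le 0$ all $\lambda_k=-1$, and if $\det T_\rho>0$ the $\lambda_k$ equal $-1$ for the two largest $|t_{kk}|$ and $+1$ for the smallest. The maximal average fidelity $F_\rho$ is the average teleportation fidelity (over uniformly distributed pure qubit inputs, standard teleportation protocol, maximized over local unitaries), attained by $\rho_C$, and the fidelity deviation $\Delta_\rho$ is the standard deviation over inputs of the fidelity when $\rho_C$ is used; explicitly $F_\rho=\frac12\bigl(1-\frac13\sum_k\tau_k\bigr)$ and $\Delta_\rho=\frac{1}{3\sqrt{10}}\sqrt{\sum_{i<j}(\tau_i-\tau_j)^2}$. The state $\rho$ is useful for UQT if $F_\rho>\frac23$ and $\Delta_\rho=0$; equivalently, $\det T_\rho<0$ and $|t_{11}|=|t_{22}|=|t_{33}|>\frac13$. *)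

(* Defs.v *)
(* MathComp + MathComp-Analysis, with R[i] from mathcomp-real-closed as the
   complex numbers over an arbitrary [R : realType]. *)
From HB Require Import structures.
From mathcomp Require Import all_boot all_order all_algebra.
From mathcomp Require Import all_classical all_reals all_analysis.
From mathcomp Require Import complex mxtens.
Import Order.TTheory GRing.Theory Num.Theory.
Import numFieldNormedType.Exports.

Set Implicit Arguments.
Unset Strict Implicit.
Unset Printing Implicit Defensive.

Local Open Scope classical_set_scope.
Local Open Scope ring_scope.
Local Open Scope complex_scope.

(* The Kronecker product [A *t B] numbers the basis lexicographically, the
   left factor being the first qubit.  The dimensions [2 * 2], [2 * (2 * 2)]
   and [2 * 2 * 2] are closed terms, so that reassociating factors is a mere
   conversion. *)

Section Qubits.
Context {R : realType}.

Definition adjmx m n (A : 'M[R[i]]_(m, n)) : 'M[R[i]]_(n, m) :=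
  map_mx Num.conj A^T.

(* The order of R[i] makes [0 <= z] imply that z is real; over the complex
   numbers this forces A to be Hermitian. *)
Definition psdmx n (A : 'M[R[i]]_n) : Prop :=
  forall v : 'cV[R[i]]_n, 0 <= (adjmx v *m A *m v) 0 0.

Definition proj_of n (v : 'cV[R[i]]_n) : 'M[R[i]]_n := v *m adjmx v.

Definition ket (b : 'I_2) : 'cV[R[i]]_2 := delta_mx b 0.

Definition mx2 (x y z t : R[i]) : 'M[R[i]]_2 :=
  \matrix_(i < 2, j < 2) nth 0 (nth [::] [:: [:: x; y]; [:: z; t]] i) j.

(* [pauli 0] is the identity; the Pauli matrices are [pauli (lift ord0 k)]
   for [k : 'I_3]. *)
Definition pauli (k : 'I_4) : 'M[R[i]]_2 :=
  [:: 1%:M; mx2 0 1 1 0; mx2 0 (- 'i) 'i 0; mx2 1 0 0 (- 1)]`_k.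

Definition sigma (k : 'I_3) : 'M[R[i]]_2 := pauli (lift ord0 k).

Definition qubit_map := {linear 'M[R[i]]_2 -> 'M[R[i]]_2}.

(* I_k (x) L, computed blockwise. *)
Definition id_tens k (L : 'M[R[i]]_2 -> 'M[R[i]]_2) (X : 'M[R[i]]_(k * 2)) :
    'M[R[i]]_(k * 2) :=
  \sum_(i < k) \sum_(j < k) delta_mx i j *t
    L (\matrix_(p, q) X (mxtens_index (i, p)) (mxtens_index (j, q))).

Definition completely_positive (L : qubit_map) : Prop :=
  forall k (X : 'M[R[i]]_(k * 2)), psdmx X -> psdmx (id_tens L X).

Definition trace_preserving (L : qubit_map) : Prop :=
  forall X, \tr (L X) = \tr X.

Definition qubit_channel (L : qubit_map) : Prop :=
  completely_positive L /\ trace_preserving L.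

Definition unital_channel (L : qubit_map) : Prop :=
  qubit_channel L /\ L 1%:M = 1%:M.

Definition concurrence (psi : 'cV[R[i]]_(2 * 2)) : R :=
  complex.Re `|(adjmx psi *m (sigma 1 *t sigma 1) *m map_mx Num.conj psi) 0 0|.

Definition corr_mx (rho : 'M[R[i]]_(2 * 2)) : 'M[R]_3 :=
  \matrix_(i, j) complex.Re (\tr (rho *m (sigma i *t sigma j))).

(* The two-qubit state rho after the local unitary U (x) V. *)
Definition local_conj (U V : 'M[R[i]]_2) (rho : 'M[R[i]]_(2 * 2)) :
    'M[R[i]]_(2 * 2) :=
  (U *t V) *m rho *m adjmx (U *t V).

Definition singlet : 'cV[R[i]]_(2 * 2) :=
  ((Num.sqrt 2)^-1)%:C *: (ket 0 *t ket 1 - ket 1 *t ket 0).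

Definition bell (k : 'I_4) : 'cV[R[i]]_(2 * 2) := (pauli k *t 1%:M) *m singlet.

(* Standard teleportation with resource rho: the unknown state phi and Alice's
   half of rho are measured in the Bell basis and, on outcome k, Bob applies
   the k-th Pauli operator.  The basis is labelled so that the correction is
   perfect for the singlet, whose correlation matrix is - 1, in accordance
   with the negative signs of the canonical form. *)
Definition bell_bra (k : 'I_4) : 'M[R[i]]_(2, 2 * 2 * 2) :=
  adjmx (bell k) *t (1%:M : 'M[R[i]]_2).

Definition teleport (rho : 'M[R[i]]_(2 * 2)) (phi : 'cV[R[i]]_2) :
    'M[R[i]]_2 :=
  \sum_(k < 4) pauli k *m
    (bell_bra k *m (proj_of phi *t rho) *m adjmx (bell_bra k)) *m
    adjmx (pauli k).

Definition fidelity (rho : 'M[R[i]]_(2 * 2)) (phi : 'cV[R[i]]_2) : R :=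
  complex.Re ((adjmx phi *m teleport rho phi *m phi) 0 0).

Definition bloch_ket (theta phi : R) : 'cV[R[i]]_2 :=
  (cos (theta / 2))%:C *: ket 0 +
  ((cos phi +i* sin phi) * (sin (theta / 2))%:C) *: ket 1.

(* Mean over the uniform distribution of pure qubit states, i.e. normalized
   area on the Bloch sphere. *)
Definition mean_pure (g : 'cV[R[i]]_2 -> R) : R :=
  (4 * pi)^-1 *
  \int[lebesgue_measure]_(phi in `[0, 2 * pi])
    \int[lebesgue_measure]_(theta in `[0, pi])
      (g (bloch_ket theta phi) * sin theta).

Definition avg_fidelity (rho : 'M[R[i]]_(2 * 2)) : R :=
  mean_pure (fidelity rho).

Definition std_fidelity (rho : 'M[R[i]]_(2 * 2)) : R :=
  Num.sqrt (mean_pure (fun phi => (fidelity rho phi - avg_fidelity rho) ^+ 2)).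

Definition max_avg_fidelity (rho : 'M[R[i]]_(2 * 2)) : R :=
  sup [set f | exists U V : 'M[R[i]]_2, [/\ U \is unitarymx, V \is unitarymx &
                 f = avg_fidelity (local_conj U V rho)]].

Definition singular_values (T : 'M[R]_3) (s : 'rV[R]_3) : Prop :=
  (forall k, 0 <= s 0 k) /\
  char_poly (T^T *m T) = \prod_(k < 3) ('X - (s 0 k ^+ 2)%:P).

Definition canonical_diag (T : 'M[R]_3) (tau : 'rV[R]_3) : Prop :=
  exists2 s : 'rV[R]_3, singular_values T s &
    if \det T <= 0 then tau = - s
    else exists2 k : 'I_3, (forall j, s 0 k <= s 0 j) &
           tau = \row_j (if j == k then s 0 j else - s 0 j).

Definition canonical_form (rho rhoC : 'M[R[i]]_(2 * 2)) : Prop :=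
  (exists U V : 'M[R[i]]_2, [/\ U \is unitarymx, V \is unitarymx &
     rhoC = local_conj U V rho]) /\
  (exists2 tau : 'rV[R]_3, canonical_diag (corr_mx rho) tau &
     corr_mx rhoC = diag_mx tau).

(* The fidelity deviation of rho is that of its canonical forms; they all have
   the same correlation matrix up to reordering the diagonal, and therefore the
   same deviation. *)
Definition fidelity_deviation (rho : 'M[R[i]]_(2 * 2)) (delta : R) : Prop :=
  exists2 rhoC, canonical_form rho rhoC & delta = std_fidelity rhoC.

Definition useful_UQT (rho : 'M[R[i]]_(2 * 2)) : Prop :=
  2 / 3 < max_avg_fidelity rho /\ fidelity_deviation rho 0.

Definition Psi (a : R) : 'cV[R[i]]_(2 * 2) :=
  (Num.sqrt a)%:C *: (ket 0 *t ket 0) +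
  (Num.sqrt (1 - a))%:C *: (ket 1 *t ket 1).

Definition shared_state (a : R) (L : qubit_map) : 'M[R[i]]_(2 * 2) :=
  id_tens L (proj_of (Psi a)).

Definition unital_channels : set qubit_map := [set L | unital_channel L].

Definition useful_channels (a : R) : set qubit_map :=
  [set L | unital_channel L /\ useful_UQT (shared_state a L)].

End Qubits.

Arguments unital_channels R : clear implicits.

(* Main.v *)
(* Fidelity is quadratic in the Bloch vector, so its mean and its standard
   deviation over the sphere depend only on the diagonal of the correlation
   matrix T.  Zero deviation makes T of the canonical form equal to -t times
   the identity; such a T is unchanged by U (x) U, so Alice's local unitary can
   be moved to Bob's side, where it is absorbed in the channel.  Unitality then
   fixes the matrix elements of the state that enter its expectation in
   sqrt (1 - a) |01> + sqrt a |10>, and positivity of this number reads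
   t <= C (1 + t) / 2; with t > 1/3 this forces C > 1/2.  Conversely, the bound
   is attained for t = C / (2 - C) by a mixture of the identity and of the
   conjugations by sigma_y and sigma_z. *)
Require Import Defs.
From HB Require Import structures.
From mathcomp Require Import all_boot all_order all_algebra.
From mathcomp Require Import all_classical all_reals all_analysis.
From mathcomp Require Import complex mxtens ring lra.
Import Order.TTheory GRing.Theory Num.Theory.
Import numFieldNormedType.Exports.
Set Implicit Arguments.
Unset Strict Implicit.
Unset Printing Implicit Defensive.
Local Open Scope classical_set_scope.
Local Open Scope ring_scope.
Local Open Scope complex_scope.

(** * Moments of quadratic forms on the Bloch sphere *)

Lemma Rintegral_antiderivative (R : realType) (f F : R -> R) (a b : R) :
  a < b -> (forall x : R, derivable F x 1) ->
  (forall x : R, 'D_1 F x = f x) -> continuous f ->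
  \int[lebesgue_measure]_(x in `[a, b]) f x = F b - F a.
Proof.
move=> ab dF DF cf.
have cF : continuous F.
  by move=> x; apply: differentiable_continuous; exact/derivable1_diffP.
rewrite /Rintegral (@continuous_FTC2 _ f F) //.
- exact: continuous_subspaceT.
- split.
  + by move=> x _.
  + by apply: cvg_at_right_filter; exact: cF.
  + by apply: cvg_at_left_filter; exact: cF.
- by move=> x _; rewrite derive1E.
Qed.

(** Serves to prove identities modulo one relation, such as [cos^2 + sin^2 = 1] or [i^2 = -1]: [k]
    is the cofactor of the relation in [x - y], and what remains is purely algebraic. *)
Lemma eq_mod_relation (R : comPzRingType) (k : R) (u v x y : R) :
  u = v -> x - y = k * (u - v) -> x = y.
Proof. by move=> ->; rewrite subrr mulr0 => /subr0_eq. Qed.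
Arguments eq_mod_relation {R} k {u v x y}.

Section SphereMean.
Context {R : realType}.
Implicit Types (g : 'cV[R[i]]_2 -> R) (x y z : R).

(** The quadratic form [diag(x, y, z)] at the unit vector with spherical coordinates [theta],
    [phi]. *)
Definition sphere_form x y z (theta phi : R) : R :=
  (x * cos phi ^+ 2 + y * sin phi ^+ 2) * sin theta ^+ 2 + z * cos theta ^+ 2.

(** Each squared coordinate of a uniform unit vector has mean 1/3; the two nested integrals are
    evaluated by explicit antiderivatives. *)
Lemma mean_pure_sphere_form g x y z :
  (forall theta phi, g (bloch_ket theta phi) = sphere_form x y z theta phi) ->
  mean_pure g = (x + y + z) / 3.
Proof.
move=> gE; rewrite /mean_pure.
pose A (phi : R) := x * cos phi ^+ 2 + y * sin phi ^+ 2.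
have inner phi : \int[lebesgue_measure]_(theta in `[0, pi])
    (g (bloch_ket theta phi) * sin theta) = 4 / 3 * A phi + 2 / 3 * z.
  under eq_Rintegral do rewrite gE.
  (* This antiderivative comes from the substitution [u = cos t], with [sin t ^+ 2 = 1 - u ^+ 2]. *)
  rewrite (@Rintegral_antiderivative _ _
    (fun t => - A phi * cos t + (A phi - z) / 3 * cos t ^+ 3)) ?pi_gt0//.
  - by rewrite cospi cos0; field.
  - move=> t; rewrite derive_val /GRing.scale /= /sphere_form -/(A phi).
    by rewrite sin2cos2; field.
  - by move=> t; apply/differentiable_continuous/derivable1_diffP.
under eq_Rintegral do rewrite inner.
rewrite (@Rintegral_antiderivative _ _ (fun p => 2 / 3 * ((x + y) * p +
    (x - y) * (cos p * sin p)) + 2 / 3 * z * p)) ?mulr_gt0 ?pi_gt0//.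
- rewrite (mulr_natl pi 2) cos2pi sin2pi cos0 sin0 -(mulr_natl pi 2).
  by have := pi_gt0 R; move: pi => q q0; field; rewrite gt_eqF.
- move=> t; rewrite derive_val /GRing.scale /= /A.
  apply: (eq_mod_relation (- (2 / 3 * (x + y))) (cos2Dsin2 t)).
  by field.
- by move=> t; apply/differentiable_continuous/derivable1_diffP.
Qed.

(** Fourth moments of a uniform unit vector [n]: the mean of [n_i^4] is 1/5 and that of
    [n_i^2 n_j^2] for distinct indices is 1/15. *)
Lemma mean_pure_sphere_form_sqr g x y z :
  (forall theta phi,
     g (bloch_ket theta phi) = sphere_form x y z theta phi ^+ 2) ->
  mean_pure g = (x ^+ 2 + y ^+ 2 + z ^+ 2) / 5 + 2 * (x * y + y * z + x * z) / 15.
Proof.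
move=> gE; rewrite /mean_pure.
pose A (phi : R) := x * cos phi ^+ 2 + y * sin phi ^+ 2.
have inner phi : \int[lebesgue_measure]_(theta in `[0, pi])
    (g (bloch_ket theta phi) * sin theta) =
    2 / 15 * (8 * A phi ^+ 2 + 4 * (A phi * z) + 3 * z ^+ 2).
  under eq_Rintegral do rewrite gE.
  rewrite (@Rintegral_antiderivative _ _
    (fun t => - A phi ^+ 2 * cos t + - (2 / 3 * (A phi * (z - A phi))) * cos t ^+ 3
       + - ((z - A phi) ^+ 2 / 5) * cos t ^+ 5)) ?pi_gt0//.
  - by rewrite cospi cos0; field.
  - move=> t; rewrite derive_val /GRing.scale /= /sphere_form -/(A phi).
    by rewrite sin2cos2; field.
  - by move=> t; apply/differentiable_continuous/derivable1_diffP.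
under eq_Rintegral do rewrite inner.
(* [A p = m + d cos(2p)]. In the antiderivative below, [cos p * sin p] is [sin(2p) / 2] and the last
   product is [sin(4p) / 4]. *)
pose m := (x + y) / 2; pose d := (x - y) / 2.
rewrite (@Rintegral_antiderivative _ _ (fun p =>
    2 / 15 * (8 * m ^+ 2 + 4 * d ^+ 2 + 4 * m * z + 3 * z ^+ 2) * p
    + 2 / 15 * (16 * m * d + 4 * d * z) * (cos p * sin p)
    + 8 / 15 * d ^+ 2 * (cos p * sin p * (cos p ^+ 2 - sin p ^+ 2))))
  ?mulr_gt0 ?pi_gt0//.
- rewrite (mulr_natl pi 2) cos2pi sin2pi cos0 sin0 -(mulr_natl pi 2) /m /d.
  by have := pi_gt0 R; move: pi => q q0; field; rewrite gt_eqF.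
- move=> t; rewrite derive_val /GRing.scale /= /A /m /d.
  set c := cos t; set s := sin t.
  apply: (eq_mod_relation (- (2 / 15 * (2 * (x + y) ^+ 2 * (1 + (c ^+ 2 + s ^+ 2))
    + 4 * (x + y) * (x - y) * (c ^+ 2 - s ^+ 2) + 2 * (x + y) * z
    + (x - y) ^+ 2 * (1 + (c ^+ 2 + s ^+ 2))))) (cos2Dsin2 t)).
  by rewrite -/c -/s; field.
- by move=> t; apply/differentiable_continuous/derivable1_diffP.
Qed.
End SphereMean.

(** * Small index sets and tensor indices *)

Lemma ord2_ind (P : 'I_2 -> Prop) : P 0 -> P 1 -> forall i, P i.
Proof.
move=> P0 P1 [[|[|//]] lt_i].
- by rewrite (_ : Ordinal lt_i = 0)//; exact: val_inj.
- by rewrite (_ : Ordinal lt_i = 1)//; exact: val_inj.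
Qed.

Lemma ord3_ind (P : 'I_3 -> Prop) : P 0 -> P 1 -> P 2 -> forall i, P i.
Proof.
move=> P0 P1 P2 [[|[|[|//]]] lt_i].
- by rewrite (_ : Ordinal lt_i = 0)//; exact: val_inj.
- by rewrite (_ : Ordinal lt_i = 1)//; exact: val_inj.
- by rewrite (_ : Ordinal lt_i = 2)//; exact: val_inj.
Qed.

Lemma sum_ord2 (V : nmodType) (F : 'I_2 -> V) : \sum_(i < 2) F i = F 0 + F 1.
Proof.
rewrite big_ord_recl big_ord1; congr (_ + F _).
exact: val_inj.
Qed.

Lemma sum_ord3 (V : nmodType) (F : 'I_3 -> V) :
  \sum_(i < 3) F i = F 0 + F 1 + F 2.
Proof.
rewrite !big_ord_recl big_ord0 addr0 addrA.
by congr (F _ + F _ + F _); exact: val_inj.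
Qed.

Lemma sum_mxtens (V : nmodType) m n (F : 'I_(m * n) -> V) :
  \sum_k F k = \sum_(i < m) \sum_(j < n) F (mxtens_index (i, j)).
Proof.
rewrite pair_bigA /= (reindex (@mxtens_index m n)) /=; last first.
  by exists (@mxtens_unindex m n) => k _; rewrite ?mxtens_indexK ?mxtens_unindexK.
by apply: eq_bigr => -[i j] _.
Qed.

(** Compared through [val], since the two index types agree only up to associativity of the product
    of the dimensions; for closed dimensions they are convertible. *)
Lemma mxtens_indexA m n p (i : 'I_m) (j : 'I_n) (k : 'I_p) :
  val (mxtens_index (i, mxtens_index (j, k))) =
  val (mxtens_index (mxtens_index (i, j), k)).
Proof. by rewrite /= mulnDl addnA mulnA. Qed.

(** * The teleportation protocol as an observable on the resource state *)

Section Teleportation.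
Context {R : realType}.
Implicit Types (A B : 'M[R[i]]_2) (rho : 'M[R[i]]_(2 * 2)) (phi : 'cV[R[i]]_2).

Lemma complex_ext (z w : R[i]) :
  complex.Re z = complex.Re w -> complex.Im z = complex.Im w -> z = w.
Proof. by case: z w => a b [c d] /= -> ->. Qed.

Lemma adjmxE m n (A : 'M[R[i]]_(m, n)) i j : adjmx A i j = conjc (A j i).
Proof. by rewrite !mxE. Qed.

Lemma adjmxM m n p (A : 'M[R[i]]_(m, n)) (B : 'M[R[i]]_(n, p)) :
  adjmx (A *m B) = adjmx B *m adjmx A.
Proof. by rewrite /adjmx trmx_mul map_mxM. Qed.

Lemma adjmxK m n (A : 'M[R[i]]_(m, n)) : adjmx (adjmx A) = A.
Proof. by apply/matrixP => i j; rewrite !adjmxE conjcK. Qed.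

Lemma adjmx_tens m n p q (A : 'M[R[i]]_(m, n)) (B : 'M[R[i]]_(p, q)) :
  adjmx (A *t B) = adjmx A *t adjmx B.
Proof. by rewrite /adjmx trmx_tens map_mxT. Qed.

Lemma adjmx1 n : adjmx (1%:M : 'M[R[i]]_n) = 1%:M.
Proof. by rewrite /adjmx trmx1 map_mx1. Qed.

Lemma unitarymx1 n : (1%:M : 'M[R[i]]_n) \is unitarymx.
Proof. by apply/unitarymxP; rewrite trmx1 map_mx1 mulmx1. Qed.

Lemma tr_mulmxE n (A B : 'M[R[i]]_n) : \tr (A *m B) = \sum_i \sum_j A i j * B j i.
Proof. by apply: eq_bigr => i _; rewrite mxE. Qed.

Lemma bell_braE k (l x i j : 'I_2) :
  bell_bra k l (mxtens_index (mxtens_index (x, i), j)) =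
  conjc (bell k (mxtens_index (x, i)) 0) * (l == j)%:R :> R[i].
Proof.
rewrite /bell_bra mxE mxtens_indexK /= adjmxE ord1 [1%:M _ _]mxE.
congr (_ * (_ == j)%:R); apply: val_inj => /=.
by rewrite modn_small.
Qed.

(* Alice's Bell outcome [k] leaves the product vector with these components
   before Bob's correction. *)
Let outcome k phi i j : R[i] :=
  (\sum_x conjc (phi x 0) * bell k (mxtens_index (x, i)) 0) *
  (adjmx (pauli k) *m phi) j 0.

(** Each Bell outcome contributes the expectation of [proj_of phi *t rho] in a single vector.
    Contracting the input qubit with [phi] turns it into the expectation of [rho] in the product
    vector [outcome k phi], so the fidelity is linear in [rho] with an explicit kernel. *)
Lemma fidelity_outcome rho phi : fidelity rho phi = complex.Re
  (\sum_i \sum_j \sum_p \sum_q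
    rho (mxtens_index (i, j)) (mxtens_index (p, q)) *
      \sum_k conjc (outcome k phi i j) * outcome k phi p q).
Proof.
rewrite /fidelity /teleport mulmx_sumr mulmx_suml summxE; congr complex.Re.
transitivity (\sum_k \sum_i \sum_j \sum_p \sum_q
    rho (mxtens_index (i, j)) (mxtens_index (p, q)) *
      (conjc (outcome k phi i j) * outcome k phi p q)); last first.
  rewrite exchange_big; apply: eq_bigr => i _.
  rewrite exchange_big; apply: eq_bigr => j _.
  rewrite exchange_big; apply: eq_bigr => p _.
  rewrite exchange_big; apply: eq_bigr => q _.
  by rewrite mulr_sumr.
apply: eq_bigr => k _.
(* Bob's correction and the final overlap with [phi] are moved onto the Bell bra. *)
pose w : 'cV[R[i]]_(2 * 2 * 2) := adjmx (bell_bra k) *m (adjmx (pauli k) *m phi).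
have wE (x i j : 'I_2) : w (mxtens_index (x, mxtens_index (i, j))) 0 =
    bell k (mxtens_index (x, i)) 0 * (adjmx (pauli k) *m phi) j 0.
  rewrite (_ : mxtens_index (x, mxtens_index (i, j)) =
               mxtens_index (mxtens_index (x, i), j));
    last exact/val_inj/mxtens_indexA.
  rewrite /w mxE (bigD1 j) //= big1 ?addr0 => [|l lj]; rewrite adjmxE bell_braE.
    by rewrite eqxx mulr1 conjcK.
  by rewrite (negbTE lj) mulr0 rmorph0 mul0r.
transitivity ((adjmx w *m (proj_of phi *t rho) *m w) 0 0).
  by rewrite /w !adjmxM !adjmxK !mulmxA.
transitivity (\sum_(x < 2) \sum_(i < 2) \sum_(j < 2)
   \sum_(y < 2) \sum_(p < 2) \sum_(q < 2)
   conjc (w (mxtens_index (x, mxtens_index (i, j))) 0) * (phi x 0 * conjc (phi y 0) *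
     rho (mxtens_index (i, j)) (mxtens_index (p, q))) *
    w (mxtens_index (y, mxtens_index (p, q))) 0).
  rewrite -mulmxA mxE (@sum_mxtens _ 2 (2 * 2)); apply: eq_bigr => x _.
  rewrite sum_mxtens; apply: eq_bigr => i _; apply: eq_bigr => j _.
  rewrite adjmxE [X in _ * X]mxE mulr_sumr (@sum_mxtens _ 2 (2 * 2)).
  apply: eq_bigr => y _.
  rewrite sum_mxtens; apply: eq_bigr => p _; apply: eq_bigr => q _.
  rewrite (@tensmxE _ 2 2 (2 * 2) (2 * 2) (proj_of phi) rho).
  by rewrite [proj_of _ _ _]mxE big_ord1 adjmxE mulrA.
rewrite sum_ord2 -big_split; apply: eq_bigr => i _.
rewrite -big_split; apply: eq_bigr => j _.
rewrite /outcome !sum_ord2 !wE; set v := (adjmx (pauli k) *m phi).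
by rewrite !(rmorphM, rmorphD) /= !conjcK; ring.
Qed.


Lemma pauliE : (pauli 0 = mx2 1 0 0 1 :> 'M[R[i]]_2) *
  (sigma 0 = mx2 0 1 1 0 :> 'M[R[i]]_2) *
  (sigma 1 = mx2 0 (0 -i* 1) (0 +i* 1) 0 :> 'M[R[i]]_2) *
  (sigma 2 = mx2 1 0 0 (-1) :> 'M[R[i]]_2).
Proof.
rewrite /sigma /pauli /=; do !split => //.
- by apply/matrixP; elim/ord2_ind; elim/ord2_ind; rewrite !mxE.
- by congr (mx2 _ _ _ _); simpc.
Qed.

Lemma mx2E (a b c d : R[i]) : (mx2 a b c d 0 0 = a) * (mx2 a b c d 0 1 = b) *
  (mx2 a b c d 1 0 = c) * (mx2 a b c d 1 1 = d).
Proof. by rewrite !mxE. Qed.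

Lemma sum_pauli (V : nmodType) (F : 'M[R[i]]_2 -> V) :
  \sum_k F (pauli k) = F (pauli 0) + F (sigma 0) + F (sigma 1) + F (sigma 2).
Proof.
rewrite big_ord_recl sum_ord3 !addrA; congr (_ + _ + _ + _).
Qed.

Lemma bellE k (x i : 'I_2) : bell k (mxtens_index (x, i)) 0 =
  ((Num.sqrt 2)^-1)%:C * (if i == 0 then - pauli k x 1 else pauli k x 0) :> R[i].
Proof.
rewrite /bell mxE sum_mxtens !sum_ord2 !tensmxE /singlet !mxE.
rewrite !mxtens_indexK /=.
by move: i; elim/ord2_ind; rewrite ?eqxx /=; ring.
Qed.

Definition bloch (l : 'I_3) phi : R :=
  complex.Re ((adjmx phi *m sigma l *m phi) 0 0).

Lemma qformE A phi (u v : 'I_1) : (adjmx phi *m A *m phi) u v =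
  \sum_i \sum_j conjc (phi i 0) * A i j * phi j 0.
Proof.
rewrite !ord1 -mulmxA mxE; apply: eq_bigr => i _.
rewrite adjmxE [X in _ * X]mxE mulr_sumr; apply: eq_bigr => j _.
by rewrite mulrA.
Qed.

(** For a unit [phi], let [n_k] be the Bloch vector of [pauli k *m phi]. Up to the factor 1/2,
    outcome [k] projects on the product of the pure states with Bloch vectors [- n_k] (Alice) and
    [n_k] (Bob). Over the four sign patterns of [n_k] the linear terms and the mixed products
    cancel, and only the squares survive. The proof compares entries. *)
Lemma sum_outcome phi i j p q :
  \sum_k conjc (outcome k phi i j) * outcome k phi p q =
  2^-1 * (((adjmx phi *m phi) 0 0) ^+ 2 * (i == p)%:R * (j == q)%:R
          - \sum_l (bloch l phi ^+ 2)%:C * (sigma l p i * sigma l q j)) :> R[i].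
Proof.
pose out A (i j : 'I_2) : R[i] := (if i == 0 then - \sum_x conjc (phi x 0) * A x 1
  else \sum_x conjc (phi x 0) * A x 0) * \sum_x conjc (A x j) * phi x 0.
have outE k i' j' : outcome k phi i' j' =
    ((Num.sqrt 2)^-1)%:C * out (pauli k) i' j'.
  rewrite /outcome /out mxE mulrA; congr (_ * _); last first.
    by apply: eq_bigr => x _; rewrite adjmxE.
  under eq_bigr do rewrite bellE.
  by case: ifP => _; rewrite -?sumrN mulr_sumr; apply: eq_bigr => x _; ring.
have half : ((Num.sqrt 2)^-1)%:C * ((Num.sqrt 2)^-1)%:C = 2^-1 :> R[i].
  by rewrite -rmorphM -expr2 exprVn sqr_sqrtr ?ler0n// fmorphV rmorphD rmorph1.
under eq_bigr do rewrite !outE rmorphM /= oppr0 mulrACA half.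
rewrite -mulr_sumr; congr (_ * _).
rewrite (sum_pauli (fun A => conjc (out A i j) * out A p q)).
(* [sigma 1] is ['i] times the real matrix [Y]. The phase cancels in [out], which has one factor
   linear in [A] and one linear in its conjugate; so all four matrices may be taken real, and
   conjugation acts on the entries of [phi] only. *)
pose Y : 'M[R[i]]_2 := mx2 0 (- 1) 1 0.
have YE : sigma 1 = 'i%C *: Y :> 'M[R[i]]_2.
  rewrite pauliE; apply/matrixP.
  by do 2 elim/ord2_ind; rewrite [RHS]mxE !mx2E; simpc.
have outY i' j' : out (sigma 1) i' j' = out Y i' j'.
  rewrite YE /out !sum_ord2 ![('i%C *: Y) _ _]mxE !rmorphM /=.
  have -> : 0 -i* 1 = - 'i%C :> R[i] by simpc.
  case: ifP => _.
    apply: (eq_mod_relation ((conjc (phi 0 0) * Y 0 1 + conjc (phi 1 0) * Y 1 1) *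
      (conjc (Y 0 j') * phi 0 0 + conjc (Y 1 j') * phi 1 0)) (sqr_i R)).
    by ring.
  apply: (eq_mod_relation (- (conjc (phi 0 0) * Y 0 0 + conjc (phi 1 0) * Y 1 0) *
    (conjc (Y 0 j') * phi 0 0 + conjc (Y 1 j') * phi 1 0)) (sqr_i R)).
  by ring.
have bE l : (bloch l phi)%:C = (adjmx phi *m sigma l *m phi) 0 0.
  rewrite /bloch !qformE !sum_ord2.
  case: (phi 0 0) (phi 1 0) => x y [z w].
  by move: l; elim/ord3_ind; rewrite !pauliE !mx2E; apply: complex_ext => /=; ring.
have bY : (bloch 1 phi ^+ 2)%:C * (sigma 1 p i * sigma 1 q j) =
    ((adjmx phi *m Y *m phi) 0 0) ^+ 2 * (Y p i * Y q j).
  have sY x y : sigma 1 x y = 'i%C * Y x y :> R[i] by rewrite YE mxE.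
  have -> : (bloch 1 phi ^+ 2)%:C = ('i%C * (adjmx phi *m Y *m phi) 0 0) ^+ 2.
    by rewrite rmorphXn /= bE YE -scalemxAr -scalemxAl mxE.
  have iM (u v : R[i]) : ('i%C * u) * ('i%C * v) = - (u * v).
    by rewrite mulrACA -expr2 sqr_i mulN1r.
  by rewrite exprMn sqr_i !sY iM; ring.
rewrite sum_ord3 !outY bY !rmorphXn /= !bE !qformE [(adjmx phi *m phi) _ _]mxE.
rewrite !sum_ord2 !adjmxE.
pose real (A : 'M[R[i]]_2) := forall x y, conjc (A x y) = A x y.
have outR A i' j' : real A -> out A i' j' =
    (if i' == 0 then - (conjc (phi 0 0) * A 0 1 + conjc (phi 1 0) * A 1 1)
     else conjc (phi 0 0) * A 0 0 + conjc (phi 1 0) * A 1 0) *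
    (A 0 j' * phi 0 0 + A 1 j' * phi 1 0).
  by move=> rA; rewrite /out !sum_ord2 !rA.
have outRc A i' j' : real A -> conjc (out A i' j') =
    (if i' == 0 then - (phi 0 0 * A 0 1 + phi 1 0 * A 1 1)
     else phi 0 0 * A 0 0 + phi 1 0 * A 1 0) *
    (A 0 j' * conjc (phi 0 0) + A 1 j' * conjc (phi 1 0)).
  move=> rA; rewrite outR // !(rmorphM, rmorphD) /= !rA.
  by case: ifP => _; rewrite !(rmorphN, rmorphM, rmorphD) /= !rA !conjcK.
have real2 (a b c d : R) : real (mx2 a%:C b%:C c%:C d%:C).
  by do 2 elim/ord2_ind; rewrite mx2E conjc_real.
have [rI [rX [rY rZ]]] : real (pauli 0) /\ real (sigma 0) /\ real Y /\ real (sigma 2).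
  rewrite !pauliE /Y; do !split; [exact: (real2 1 0 0 1)|exact: (real2 0 1 1 0)| |];
  by do 2 elim/ord2_ind; rewrite mx2E ?rmorphN ?rmorph0 ?rmorph1.
rewrite !outRc // !outR // {rI rX rY rZ outR outRc outY bY bE outE half} !pauliE /Y.
move: (phi 0 0) (phi 1 0) => a b.
by move: i j p q; do 4 elim/ord2_ind; rewrite /= !mx2E; ring.
Qed.

End Teleportation.

(** * Mean and standard deviation of the fidelity *)

Section Fidelity.
Context {R : realType}.
Implicit Types (A B : 'M[R[i]]_2) (rho : 'M[R[i]]_(2 * 2)) (phi : 'cV[R[i]]_2).

Lemma ReD (z w : R[i]) : complex.Re (z + w) = complex.Re z + complex.Re w.
Proof. by case: z w => a b []. Qed.

Lemma ReB (z w : R[i]) : complex.Re (z - w) = complex.Re z - complex.Re w.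
Proof. by case: z w => a b []. Qed.

Lemma Re_scale (x : R) (z : R[i]) : complex.Re (x%:C * z) = x * complex.Re z.
Proof. by case: z => a b; simpc. Qed.

Lemma corr_mxE rho i j :
  corr_mx rho i j = complex.Re (\tr (rho *m (sigma i *t sigma j))).
Proof. exact: mxE. Qed.

Lemma mxtraceB n (A B : 'M[R[i]]_n) : \tr (A - B) = \tr A - \tr B.
Proof. exact: raddfB. Qed.

Lemma tens1mx1 m n : (1%:M : 'M[R[i]]_m) *t (1%:M : 'M[R[i]]_n) = 1%:M.
Proof.
apply/matrixP => k l; case: (mxtens_indexP k) => i j; case: (mxtens_indexP l) => p q.
rewrite tensmxE !mxE -natrM mulnb (can_eq (@mxtens_indexK _ _)).
by rewrite xpair_eqE.
Qed.

Lemma fidelityE rho phi : (adjmx phi *m phi) 0 0 = 1 ->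
  fidelity rho phi =
  (complex.Re (\tr rho) - \sum_l bloch l phi ^+ 2 * corr_mx rho l l) / 2.
Proof.
move=> phi1; rewrite fidelity_outcome.
under eq_bigr do under eq_bigr do under eq_bigr do under eq_bigr do
  rewrite sum_outcome phi1 expr1n mul1r.
pose X := \sum_l (bloch l phi ^+ 2)%:C * \tr (rho *m (sigma l *t sigma l)).
transitivity (complex.Re ((2^-1 : R)%:C * (\tr rho - X))).
  (* [S] is the observable measured by the protocol for the input [phi]: the fidelity is the real
     part of [\tr (rho *m S)]. *)
  pose S : 'M[R[i]]_(2 * 2) := 2^-1 *:
    (1%:M *t 1%:M - \sum_l (bloch l phi ^+ 2)%:C *: (sigma l *t sigma l)).
  have -> : (2^-1 : R)%:C = 2^-1 by rewrite fmorphV rmorphD rmorph1.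
  congr complex.Re; transitivity (\tr (rho *m S)).
    rewrite tr_mulmxE sum_mxtens; apply: eq_bigr => i _; apply: eq_bigr => j _.
    rewrite sum_mxtens; apply: eq_bigr => p _; apply: eq_bigr => q _.
    congr (_ * _); rewrite [RHS]mxE; congr (_ * _); rewrite [RHS]mxE tensmxE.
    rewrite !mxE !(eq_sym p) !(eq_sym q) summxE; congr (_ - _).
    by apply: eq_bigr => l _; rewrite mxE tensmxE.
  rewrite /S -scalemxAr mxtraceZ mulmxBr mxtraceB tens1mx1 mulmx1.
  rewrite mulmx_sumr (raddf_sum mxtrace); congr (_ * (_ - _)).
  by apply: eq_bigr => l _; rewrite /= -scalemxAr mxtraceZ.
have -> : \sum_l bloch l phi ^+ 2 * corr_mx rho l l = complex.Re X.
  rewrite /X !sum_ord3 !ReD !corr_mxE.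
  by congr (_ + _ + _); exact/esym/Re_scale.
by rewrite Re_scale ReB mulrC.
Qed.

Lemma bloch_ketE (t p : R) : (bloch_ket t p 0 0 = (cos (t / 2))%:C) *
  (bloch_ket t p 1 0 = (cos p * sin (t / 2)) +i* (sin p * sin (t / 2))).
Proof. by rewrite /bloch_ket /ket !mxE /=; split; simpc. Qed.

Lemma bloch_ket_unit (t p : R) :
  (adjmx (bloch_ket t p) *m bloch_ket t p) 0 0 = 1 :> R[i].
Proof.
rewrite mxE sum_ord2 !adjmxE !bloch_ketE; simpc.
rewrite (_ : 1 = 1 +i* 0)//; congr (_ +i* _); last by ring.
rewrite -[RHS](cos2Dsin2 (t / 2)) -[X in _ = _ + X]mul1r -(cos2Dsin2 p); ring.
Qed.

Lemma bloch_bloch_ket (t p : R) :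
  (bloch 0 (bloch_ket t p) = sin t * cos p :> R) *
  (bloch 1 (bloch_ket t p) = sin t * sin p :> R) *
  (bloch 2 (bloch_ket t p) = cos t :> R).
Proof.
rewrite /bloch !qformE !sum_ord2 !pauliE !mx2E !bloch_ketE /=.
have -> : sin t = 2 * (cos (t / 2) * sin (t / 2)).
  by rewrite {1}(_ : t = (t / 2) *+ 2) ?sin_mulr2n ?mulr_natl//; field.
have -> : cos t = cos (t / 2) ^+ 2 - sin (t / 2) ^+ 2.
  by rewrite {1}(_ : t = (t / 2) + (t / 2)) ?cosD -?expr2//; field.
do !split; [ring|ring|].
by apply: (eq_mod_relation (- sin (t / 2) ^+ 2) (cos2Dsin2 p)); ring.
Qed.

Lemma fidelity_bloch_ket rho (t p : R) :
  fidelity rho (bloch_ket t p) =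
  sphere_form ((complex.Re (\tr rho) - corr_mx rho 0 0) / 2)
    ((complex.Re (\tr rho) - corr_mx rho 1 1) / 2)
    ((complex.Re (\tr rho) - corr_mx rho 2 2) / 2) t p.
Proof.
rewrite fidelityE ?bloch_ket_unit// sum_ord3 !bloch_bloch_ket /sphere_form.
set a := corr_mx _ _ _; set b := corr_mx _ _ _; set c := corr_mx _ _ _.
set T := complex.Re _.
by rewrite !exprMn sin2cos2 (sin2cos2 t); field.
Qed.

Lemma avg_fidelityE rho :
  avg_fidelity rho = (complex.Re (\tr rho) - \tr (corr_mx rho) / 3) / 2.
Proof.
rewrite /avg_fidelity (mean_pure_sphere_form (fidelity_bloch_ket rho)).
by rewrite /mxtrace sum_ord3; field.
Qed.

Lemma std_fidelityE rho : let T := corr_mx rho in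
  std_fidelity rho = Num.sqrt
    (((T 0 0 - T 1 1) ^+ 2 + (T 0 0 - T 2 2) ^+ 2 + (T 1 1 - T 2 2) ^+ 2) / 90).
Proof.
move=> T; rewrite /std_fidelity; congr Num.sqrt.
(* Since the squared coordinates of a unit vector add up to 1, subtracting the mean leaves a
   quadratic form, with coefficients [(m - T l l) / 2]; the trace of [rho] cancels. *)
pose m := \tr T / 3.
rewrite (@mean_pure_sphere_form_sqr _ _ ((m - T 0 0) / 2) ((m - T 1 1) / 2)
  ((m - T 2 2) / 2)).
  by rewrite /m /mxtrace sum_ord3; field.
move=> t p; congr (_ ^+ 2).
rewrite fidelity_bloch_ket avg_fidelityE -/T -/m /sphere_form.
by rewrite (sin2cos2 t) (sin2cos2 p); field.
Qed.

End Fidelity.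

(** * Local unitaries acting on isotropic correlation matrices *)

Section LocalUnitaries.
Context {R : realType}.
Implicit Types (A B U V : 'M[R[i]]_2) (rho : 'M[R[i]]_(2 * 2)).

Lemma Re_sum I (r : seq I) (F : I -> R[i]) :
  complex.Re (\sum_(k <- r) F k) = \sum_(k <- r) complex.Re (F k).
Proof. exact: (big_morph _ (@ReD R)). Qed.

Lemma unitarymx_adj U : U \is unitarymx -> U *m adjmx U = 1%:M.
Proof. exact: unitarymxP. Qed.

Lemma adjmx_unitarymx U : U \is unitarymx -> adjmx U *m U = 1%:M.
Proof. by move/unitarymx_adj/mulmx1C. Qed.

Lemma unitarymx_adjmx U : U \is unitarymx -> adjmx U \is unitarymx.
Proof. by rewrite trmxC_unitary. Qed.

Lemma mxtrace_tens m n (A : 'M[R[i]]_m) (B : 'M[R[i]]_n) :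
  \tr (A *t B) = \tr A * \tr B.
Proof.
rewrite /mxtrace sum_mxtens mulr_suml; apply: eq_bigr => i _.
by rewrite mulr_sumr; apply: eq_bigr => j _; rewrite tensmxE.
Qed.

Lemma local_conjM U V U' V' rho :
  local_conj U V (local_conj U' V' rho) = local_conj (U *m U') (V *m V') rho.
Proof. by rewrite /local_conj -tensmx_mul adjmxM !mulmxA. Qed.

Lemma local_conj1 rho : local_conj 1%:M 1%:M rho = rho.
Proof.
by rewrite /local_conj adjmx_tens adjmx1 tens1mx1 mul1mx mulmx1.
Qed.

Lemma local_conjK U V rho : U \is unitarymx -> V \is unitarymx ->
  local_conj (adjmx U) (adjmx V) (local_conj U V rho) = rho.
Proof. by move=> uU uV; rewrite local_conjM !adjmx_unitarymx// local_conj1. Qed.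

Lemma mxtrace_local_conj U V rho A B :
  \tr (local_conj U V rho *m (A *t B)) =
  \tr (rho *m ((adjmx U *m A *m U) *t (adjmx V *m B *m V))).
Proof.
by rewrite -!tensmx_mul -adjmx_tens /local_conj -!mulmxA mxtrace_mulC !mulmxA.
Qed.

Lemma mxtrace_local_conj1 U V rho : U \is unitarymx -> V \is unitarymx ->
  \tr (local_conj U V rho) = \tr rho.
Proof.
move=> uU uV; rewrite -[local_conj _ _ _]mulmx1 -tens1mx1 mxtrace_local_conj.
by rewrite !mulmx1 !adjmx_unitarymx// tens1mx1 mulmx1.
Qed.

Lemma psdmx_conj m n (M : 'M[R[i]]_(m, n)) (X : 'M[R[i]]_n) :
  psdmx X -> psdmx (M *m X *m adjmx M).
Proof. by move=> pX v; have := pX (adjmx M *m v); rewrite adjmxM adjmxK !mulmxA. Qed.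

Definition traceless_herm A := adjmx A = A /\ \tr A = 0.

(** The Pauli matrices are orthogonal for the trace form, with squared norm 2; hence the
    division. *)
Definition pauli_coord A (l : 'I_3) : R := complex.Re (\tr (A *m sigma l)) / 2.

Lemma traceless_herm_conj U A : U \is unitarymx ->
  traceless_herm A -> traceless_herm (adjmx U *m A *m U).
Proof.
move=> uU [hA tA]; split; first by rewrite !adjmxM adjmxK hA mulmxA.
by rewrite -mulmxA mxtrace_mulC -mulmxA unitarymx_adj// mulmx1.
Qed.

Lemma traceless_herm_sigma l : traceless_herm (sigma l : 'M[R[i]]_2).
Proof.
split; last first.
  by move: l; elim/ord3_ind; rewrite /mxtrace sum_ord2 pauliE !mx2E; simpc.
apply/matrixP => i j; rewrite adjmxE; move: i j l.
by do 2 elim/ord2_ind; elim/ord3_ind; rewrite pauliE !mx2E; simpc.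
Qed.

Lemma traceless_hermE A : traceless_herm A ->
  A = \sum_l (pauli_coord A l)%:C *: sigma l.
Proof.
move=> [hA]; rewrite /mxtrace sum_ord2 => tA.
have hE i j : A i j = conjc (A j i) by rewrite -[in LHS]hA adjmxE.
have h10 := hE 1 0; have h00 := hE 0 0; move: tA h10 h00 {hE hA}.
rewrite sum_ord3 /pauli_coord !tr_mulmxE !sum_ord2 !pauliE !mx2E.
case E00: (A 0 0) => [a a']; case E01: (A 0 1) => [b b'].
case E10: (A 1 0) => [c c']; case E11: (A 1 1) => [d d'].
move=> tA; move: (congr1 (@complex.Im R) tA) (congr1 (@complex.Re R) tA) => {tA}.
move=> /= ad' ad [ec ec'] [a0]; simpc.
apply/matrixP; do 2 elim/ord2_ind;
  rewrite !mxE ?E00 ?E01 ?E10 ?E11 /=; simpc; congr (_ +i* _); lra.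
Qed.

Lemma mxtrace_mul_traceless A B : traceless_herm B ->
  complex.Re (\tr (A *m B)) = 2 * \sum_l pauli_coord A l * pauli_coord B l.
Proof.
move=> /traceless_hermE {1}->; rewrite mulmx_sumr (raddf_sum mxtrace) Re_sum.
rewrite mulr_sumr; apply: eq_bigr => l _ /=.
by rewrite -scalemxAr mxtraceZ Re_scale /pauli_coord; field.
Qed.

(** Unitary conjugation is an isometry of the Bloch space, because the squared norm of the
    coordinates is half the trace of [A *m A]. *)
Lemma pauli_coord_conj U A : U \is unitarymx -> traceless_herm A ->
  \sum_l pauli_coord (adjmx U *m A *m U) l ^+ 2 = \sum_l pauli_coord A l ^+ 2.
Proof.
move=> uU hA; have hA' := traceless_herm_conj uU hA.
suff : complex.Re (\tr ((adjmx U *m A *m U) *m (adjmx U *m A *m U))) =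
       complex.Re (\tr (A *m A)).
  rewrite !mxtrace_mul_traceless// => /mulfI; apply.
  by rewrite pnatr_eq0.
congr complex.Re; rewrite -!mulmxA mxtrace_mulC -!mulmxA.
by rewrite !(mulmxA U (adjmx U)) !unitarymx_adj// mul1mx mulmx1.
Qed.

Lemma pauli_coord_sigma k l : pauli_coord (sigma k) l = (k == l)%:R .
Proof.
rewrite /pauli_coord tr_mulmxE !sum_ord2.
by move: k l; do 2 elim/ord3_ind; rewrite !pauliE !mx2E /=; field.
Qed.

(** By bilinearity, an isotropic correlation matrix sees a product observable only through the
    Euclidean inner product of its two coordinate vectors. *)
Lemma Re_mxtrace_tens rho A B (tau : R) :
  corr_mx rho = tau%:M -> traceless_herm A -> traceless_herm B ->
  complex.Re (\tr (rho *m (A *t B))) =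
  tau * \sum_l pauli_coord A l * pauli_coord B l.
Proof.
move=> rhoE hA hB; pose a := pauli_coord A; pose b := pauli_coord B.
have -> : A *t B = \sum_k \sum_l (a k * b l)%:C *: (sigma k *t sigma l).
  rewrite {1}(traceless_hermE hA) {1}(traceless_hermE hB).
  apply/matrixP => u v; case: (mxtens_indexP u) (mxtens_indexP v) => i j [p q].
  rewrite tensmxE !summxE mulr_suml; apply: eq_bigr => k _.
  rewrite !summxE mulr_sumr; apply: eq_bigr => l _.
  rewrite -/(a k) -/(b l) [X in X * _ = _]mxE [X in _ * X = _]mxE [RHS]mxE tensmxE.
  by rewrite mulrACA -rmorphM.
rewrite mulmx_sumr (raddf_sum mxtrace) Re_sum mulr_sumr; apply: eq_bigr => k _ /=.
rewrite mulmx_sumr (raddf_sum mxtrace) Re_sum (bigD1 k) //= big1 => [|l lk].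
  by rewrite addr0 -scalemxAr mxtraceZ Re_scale -corr_mxE rhoE mxE eqxx mulr1n mulrC.
by rewrite -scalemxAr mxtraceZ Re_scale -corr_mxE rhoE mxE eq_sym (negbTE lk) mulr0.
Qed.

(** The same unitary on both sides rotates both coordinate vectors alike, and so keeps their inner
    product, which is half the trace of the product of the two matrices. *)
Lemma corr_mx_local_conj_same U rho tau : U \is unitarymx ->
  corr_mx rho = tau%:M -> corr_mx (local_conj U U rho) = tau%:M.
Proof.
move=> uU rhoE; apply/matrixP => k l.
rewrite corr_mxE mxtrace_local_conj.
have hs k' := traceless_herm_conj uU (traceless_herm_sigma k').
rewrite (Re_mxtrace_tens rhoE (hs k) (hs l)) [RHS]mxE -mulr_natr; congr (_ * _).
suff : complex.Re (\tr ((adjmx U *m sigma k *m U) *m (adjmx U *m sigma l *m U)))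
   = 2 * (k == l)%:R :> R.
  by rewrite mxtrace_mul_traceless// => /mulfI; apply; rewrite pnatr_eq0.
rewrite -!mulmxA mxtrace_mulC -!mulmxA !(mulmxA U (adjmx U)) !unitarymx_adj//.
rewrite mul1mx mulmx1 mxtrace_mul_traceless; last exact: traceless_herm_sigma.
congr (_ * _); rewrite (bigD1 l) //= big1 => [|m ml].
  by rewrite !pauli_coord_sigma eqxx mulr1 addr0.
by rewrite !pauli_coord_sigma (eq_sym l) (negbTE ml) mulr0.
Qed.

(** After the rotations each diagonal correlation is [tau] times an inner product of two unit
    vectors, hence at least [tau] because [tau <= 0]. No choice of local unitaries therefore beats
    the isotropic form. *)
Lemma avg_fidelity_local_conj_le U V rho tau :
  U \is unitarymx -> V \is unitarymx ->
  \tr rho = 1 -> corr_mx rho = tau%:M -> tau <= 0 ->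
  avg_fidelity (local_conj U V rho) <= (1 - tau) / 2.
Proof.
move=> uU uV tr1 rhoE tau0.
rewrite avg_fidelityE mxtrace_local_conj1// tr1 /=.
suff : 3 * tau <= \tr (corr_mx (local_conj U V rho)) by lra.
rewrite /mxtrace mulr_natl -[X in _ *+ X](card_ord 3) -sumr_const.
apply: ler_sum => k _.
have hU := traceless_herm_conj uU (traceless_herm_sigma k).
have hV := traceless_herm_conj uV (traceless_herm_sigma k).
rewrite corr_mxE mxtrace_local_conj (Re_mxtrace_tens rhoE hU hV).
rewrite -[leLHS]mulr1 ler_wnM2l//.
have norm W : W \is unitarymx ->
    \sum_l pauli_coord (adjmx W *m sigma k *m W) l ^+ 2 = 1 :> R.
  move=> uW; rewrite pauli_coord_conj//; last exact: traceless_herm_sigma.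
  rewrite (bigD1 k) //= big1 => [|l lk]; rewrite pauli_coord_sigma.
    by rewrite eqxx expr1n addr0.
  by rewrite eq_sym (negbTE lk) expr0n.
(* Writing 1 as the half sum of the two squared norms reduces the Cauchy-Schwarz inequality to
   [2xy <= x^2 + y^2] termwise. *)
have -> : 1 = \sum_l (pauli_coord (adjmx U *m sigma k *m U) l ^+ 2
    + pauli_coord (adjmx V *m sigma k *m V) l ^+ 2) / 2 :> R.
  by rewrite -mulr_suml big_split /= (norm U uU) (norm V uV); field.
apply: ler_sum => l _; set x := pauli_coord _ _; set y := pauli_coord _ _.
by have := sqr_ge0 (x - y); rewrite sqrrB; lra.
Qed.


End LocalUnitaries.

(** * Constraints on a state shared through a unital channel *)

Section SharedState.
Context {R : realType}.
Implicit Types (A B U V W : 'M[R[i]]_2) (L : @qubit_map R) (a : R).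

Definition amplitude a (i : 'I_2) : R :=
  if i == 0 then Num.sqrt a else Num.sqrt (1 - a).

Lemma PsiE a (i j : 'I_2) :
  Psi a (mxtens_index (i, j)) 0 = (amplitude a i)%:C * (i == j)%:R.
Proof.
rewrite /Psi /ket [LHS]mxE [X in X + _]mxE [X in _ + X]mxE.
have -> : (0 : 'I_(1 * 1)) = mxtens_index (0, 0) by exact: val_inj.
rewrite !tensmxE !mxE /amplitude.
by move: i j; do 2 elim/ord2_ind; rewrite /=; ring.
Qed.

Lemma shared_stateE a L : shared_state a L =
  \sum_i \sum_p (amplitude a i * amplitude a p)%:C *:
    (delta_mx i p *t L (delta_mx i p)).
Proof.
rewrite /shared_state /id_tens; apply: eq_bigr => i _; apply: eq_bigr => p _.
rewrite (_ : \matrix_(_, _) _ = (amplitude a i * amplitude a p)%:C *: delta_mx i p).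
  by rewrite linearZ; apply/matrixP => u v; rewrite !mxE mulrCA.
apply/matrixP => j q; rewrite [LHS]mxE [LHS]mxE big_ord1 adjmxE !PsiE.
have -> (r : R) (b : bool) : conjc (r%:C * b%:R) = r%:C * b%:R by case: b; simpc.
rewrite [RHS]mxE [X in _ = _ * X]mxE rmorphM /= mulrACA -natrM mulnb.
by rewrite (eq_sym i) (eq_sym p).
Qed.

Lemma mxtrace_shared_state a L W A B :
  \tr (local_conj 1%:M W (shared_state a L) *m (A *t B)) =
  \sum_i \sum_p (amplitude a i * amplitude a p)%:C *
    (A p i * \tr (W *m L (delta_mx i p) *m adjmx W *m B)).
Proof.
rewrite mxtrace_local_conj adjmx1 mul1mx mulmx1 shared_stateE.
rewrite mulmx_suml (raddf_sum mxtrace); apply: eq_bigr => i _ /=.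
rewrite mulmx_suml (raddf_sum mxtrace); apply: eq_bigr => p _ /=.
rewrite -scalemxAl mxtraceZ tensmx_mul mxtrace_tens; congr (_ * (_ * _)).
  rewrite tr_mulmxE (bigD1 i) //= (bigD1 p) //= !big1 => [|k ki|k kp].
  - by rewrite mxE !eqxx mul1r !addr0.
  - by apply: big1 => l _; rewrite mxE (negbTE ki) mul0r.
  - by rewrite mxE (negbTE kp) andbF mul0r.
by rewrite -!mulmxA (mxtrace_mulC W) !mulmxA.
Qed.

Lemma mxtrace_shared_state1 a L : 0 <= a <= 1 -> trace_preserving L ->
  \tr (shared_state a L) = 1.
Proof.
move=> /andP[a0 a1] tL; rewrite shared_stateE (raddf_sum mxtrace) /=.
under eq_bigr => i _.
  rewrite (raddf_sum mxtrace) /=.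
  under eq_bigr => p _ do rewrite mxtraceZ mxtrace_tens tL /mxtrace !sum_ord2 !mxE.
  over.
rewrite !sum_ord2 /amplitude /= -!expr2 !sqr_sqrtr ?subr_ge0//.
by rewrite rmorphB rmorph1; ring.
Qed.

Lemma psdmx_mxtrace n (X : 'M[R[i]]_n) (w : 'cV[R[i]]_n) :
  psdmx X -> 0 <= complex.Re (\tr (X *m proj_of w)).
Proof.
move=> /(_ w); rewrite /proj_of mulmxA mxtrace_mulC mulmxA /mxtrace big_ord1.
by rewrite lecE => /andP[].
Qed.

Lemma psdmx_shared_state a L : completely_positive L -> psdmx (shared_state a L).
Proof.
apply=> v; rewrite /proj_of mulmxA -mulmxA.
set z := adjmx v *m Psi a; have -> : adjmx (Psi a) *m v = adjmx z.
  by rewrite /z adjmxM adjmxK.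
by rewrite mxE big_ord1 adjmxE mulcJ_ge0.
Qed.

Lemma mxtrace_mul_sum3 n (rho M1 M2 M3 M4 : 'M[R[i]]_n) c1 c2 c3 :
  \tr (rho *m (c1 *: M1 + c2 *: (M2 + M3) + c3 *: M4)) =
  c1 * \tr (rho *m M1) + c2 * (\tr (rho *m M2) + \tr (rho *m M3)) +
  c3 * \tr (rho *m M4).
Proof. by rewrite !mulmxDr -!scalemxAr mulmxDr !mxtraceD !mxtraceZ mxtraceD. Qed.

Lemma delta_mxE m n (i k : 'I_m) (j l : 'I_n) :
  delta_mx i j k l = ((k == i) && (l == j))%:R :> R[i].
Proof. exact: mxE. Qed.

Lemma sum_mul_delta m n (c t : 'I_n -> 'I_m -> R[i]) i j :
  \sum_k \sum_p c k p * (delta_mx i j p k * t k p) = c j i * t j i.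
Proof.
rewrite (bigD1 j) //= (bigD1 i) //= !big1 => [|k kj|p pi].
- by rewrite delta_mxE !eqxx mul1r !addr0.
- by apply: big1 => p _; rewrite delta_mxE (negbTE kj) andbF mul0r mulr0.
- by rewrite delta_mxE (negbTE pi) mul0r mulr0.
Qed.

Lemma tr_mul_delta A i j : \tr (A *m delta_mx i j) = A j i.
Proof.
rewrite tr_mulmxE; move: i j; do 2 elim/ord2_ind; rewrite !sum_ord2 !mxE /=.
all: by rewrite !(mulr0, mulr1, addr0, add0r).
Qed.

Lemma tr_mul_sigma0 A : \tr (A *m sigma 0) = A 0 1 + A 1 0.
Proof. by rewrite tr_mulmxE !sum_ord2 pauliE !mx2E; ring. Qed.

Lemma tr_mul_sigma1 A : \tr (A *m sigma 1) = 'i%C * (A 0 1 - A 1 0).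
Proof.
rewrite tr_mulmxE !sum_ord2 pauliE !mx2E.
have -> : 0 -i* 1 = - 'i%C :> R[i] by simpc.
by ring.
Qed.

Lemma tr_mul_sigma2 A : \tr (A *m sigma 2) = A 0 0 - A 1 1.
Proof. by rewrite tr_mulmxE !sum_ord2 pauliE !mx2E; ring. Qed.

(** With [t = - tau] and concurrence [C], this is [t <= C (1 + t) / 2]. It compares the [zz]
    correlation, which fixes a population, with the sum of the [xx] and [yy] ones, which fixes a
    coherence. *)
Lemma unital_channel_bound a L W (tau : R) : 0 < a < 1 -> unital_channel L ->
  W \is unitarymx ->
  corr_mx (local_conj 1%:M W (shared_state a L)) = tau%:M ->
  - tau <= Num.sqrt a * Num.sqrt (1 - a) * (1 - tau).
Proof.
move=> /andP[a0 a1] [[cpL tL] L1] uW corrE.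
(* Blocks of the Choi matrix of [L] followed by conjugation by [W]. Trace preservation enters
   through [trK], unitality through [sumK]. *)
pose K i p := W *m L (delta_mx i p) *m adjmx W.
pose x := Num.sqrt a; pose y := Num.sqrt (1 - a).
have x0 : 0 < x by rewrite sqrtr_gt0.
have y0 : 0 < y by rewrite sqrtr_gt0 subr_gt0.
have trK : K 0 0 0 0 + K 0 0 1 1 = 1.
  transitivity (\tr (K 0 0)); first by rewrite /mxtrace sum_ord2.
  rewrite /K -mulmxA mxtrace_mulC -mulmxA adjmx_unitarymx// mulmx1 tL.
  by rewrite /mxtrace sum_ord2 !mxE addr0.
have sumK j : K 0 0 j j + K 1 1 j j = 1.
  transitivity ((K 0 0 + K 1 1) j j); first by rewrite [RHS]mxE.
  rewrite /K -mulmxDl -mulmxDr -linearD.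
  have -> : delta_mx 0 0 + delta_mx 1 1 = 1%:M :> 'M[R[i]]_2.
    by apply/matrixP; do 2 elim/ord2_ind; rewrite !mxE /= ?addr0 ?add0r.
  by rewrite L1 mulmx1 unitarymx_adj// mxE eqxx.
have trE A B : \tr (local_conj 1%:M W (shared_state a L) *m (A *t B)) =
    (x * x)%:C * (A 0 0 * \tr (K 0 0 *m B)) + (x * y)%:C * (A 1 0 * \tr (K 0 1 *m B)) +
    ((y * x)%:C * (A 0 1 * \tr (K 1 0 *m B)) + (y * y)%:C * (A 1 1 * \tr (K 1 1 *m B))).
  by rewrite mxtrace_shared_state sum_ord2; congr (_ + _); rewrite sum_ord2.
have trD i j k l : \tr (local_conj 1%:M W (shared_state a L) *m
    (delta_mx i j *t delta_mx k l)) =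
    (amplitude a j * amplitude a i)%:C * K j i l k.
  rewrite mxtrace_shared_state (sum_mul_delta (fun i p => _%:C)
    (fun i p => \tr (W *m L (delta_mx i p) *m adjmx W *m _))).
  by rewrite tr_mul_delta.
clearbody K.
have corr k : complex.Re
    (\tr (local_conj 1%:M W (shared_state a L) *m (sigma k *t sigma k))) = tau.
  by rewrite -corr_mxE corrE mxE eqxx.
have xxyy1 : x * x + y * y = 1.
  by rewrite -!expr2 !sqr_sqrtr ?subr_ge0 ?ltW//; ring.
(* [trK] and [sumK] leave one free population, and the block weights satisfy [x * x + y * y = 1], so
   the [zz] correlation does not depend on [a]. *)
have zz : tau = 1 - 2 * complex.Re (K 0 0 1 1).
  rewrite -(corr 2) trE !tr_mul_sigma2 pauliE !mx2E.
  have -> : K 0 0 0 0 = 1 - K 0 0 1 1 by apply: (addIr (K 0 0 1 1)); rewrite trK subrK.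
  have -> : K 1 1 0 0 = K 0 0 1 1.
    by apply: (addrI (K 0 0 0 0)); rewrite sumK trK.
  have -> : K 1 1 1 1 = 1 - K 0 0 1 1.
    by apply: (addrI (K 0 0 1 1)); rewrite sumK addrC subrK.
  have -> (z : R[i]) : 1 - 2 * complex.Re z =
      complex.Re ((x * x + y * y)%:C * (1 - 2%:C * z)).
    by rewrite xxyy1 mul1r ReB Re_scale.
  by congr complex.Re; rewrite rmorphD; ring.
(* Adding the [xx] and [yy] correlations cancels [K 0 1 0 1] and [K 1 0 1 0], leaving exactly the
   coherences seen by the test vector [w] below. *)
have xxyy : tau = x * y * complex.Re (K 0 1 1 0 + K 1 0 0 1).
  apply: (@mulfI _ 2); first by rewrite pnatr_eq0.
  have -> (u : R) (z : R[i]) : 2 * (u * complex.Re z) = complex.Re (2%:C * u%:C * z).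
    by rewrite -rmorphM Re_scale mulrA.
  rewrite mulr_natl mulr2n -[X in X + _ = _](corr 0) -[X in _ + X = _](corr 1) -ReD.
  rewrite !trE (mulrC y x).
  rewrite !tr_mul_sigma0 !tr_mul_sigma1 !pauliE !mx2E; congr complex.Re.
  have -> : 0 -i* 1 = - 'i%C :> R[i] by simpc.
  have -> : 0 +i* 1 = 'i%C :> R[i] by [].
  rewrite (_ : 2%:C = 2 :> R[i]); last by rewrite rmorph_nat.
  apply: (eq_mod_relation ((x * y)%:C * (K 0 1 0 1 - K 0 1 1 0 - K 1 0 0 1 + K 1 0 1 0))
    (sqr_i R)).
  by ring.
(* The amplitudes are swapped relative to [Psi a], so that every matrix element of the state in the
   expectation receives the same total weight [(x * y) ^+ 2], which can be divided out. *)
pose w : 'cV[R[i]]_(2 * 2) := y%:C *: (ket 0 *t ket 1) + x%:C *: (ket 1 *t ket 0).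
have := psdmx_mxtrace w (psdmx_conj (1%:M *t W) (psdmx_shared_state a cpL)).
rewrite -/(local_conj 1%:M W (shared_state a L)).
move: (local_conj _ _ _) trD => rho trD.
have -> : proj_of w = (y * y)%:C *: (delta_mx 0 0 *t delta_mx 1 1) +
   (x * y)%:C *: (delta_mx 0 1 *t delta_mx 1 0 + delta_mx 1 0 *t delta_mx 0 1) +
   (x * x)%:C *: (delta_mx 1 1 *t delta_mx 0 0).
  apply/matrixP => u v; case: (mxtens_indexP u) (mxtens_indexP v) => i j [p q].
  rewrite /proj_of mxE big_ord1 adjmxE /w /ket !mxE !mxtens_indexK /=.
  rewrite !ord1 !eqxx !andbT.
  have -> (b c b' c' : bool) : conjc (y%:C * (b%:R * c%:R) + x%:C * (b'%:R * c'%:R)) =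
      y%:C * (b%:R * c%:R) + x%:C * (b'%:R * c'%:R).
    have cb r (d : bool) : conjc (r%:C * d%:R) = r%:C * d%:R :> R[i].
      by case: d; simpc.
    have conjcD (s t : R[i]) : conjc (s + t) = conjc s + conjc t by exact: rmorphD.
    by rewrite -!natrM !mulnb conjcD !cb.
  rewrite !rmorphM /=.
  by move: i j p q; do 4 elim/ord2_ind; rewrite /=; ring.
rewrite mxtrace_mul_sum3 !trD /amplitude /= -/x -/y (mulrC y x).
have -> : K 1 1 0 0 = K 0 0 1 1.
  by apply: (addrI (K 0 0 0 0)); rewrite sumK trK.
set z := K 0 0 1 1; set S := K 0 1 1 0 + K 1 0 0 1.
rewrite (_ : complex.Re _ =
  (x * y) ^+ 2 * (2 * complex.Re z + complex.Re S)); last first.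
  rewrite -[2 * complex.Re z]Re_scale -ReD -Re_scale; congr complex.Re.
  rewrite expr2 !rmorphM /= (_ : 2%:C = 2 :> R[i]); last by rewrite rmorph_nat.
  by rewrite /S; ring.
rewrite pmulr_rge0 ?exprn_gt0 ?mulr_gt0// -/x -/y => zS.
have := mulr_ge0 (ltW (mulr_gt0 x0 y0)) zS.
by rewrite mulrDr -xxyy zz; lra.
Qed.

End SharedState.

(** * Usefulness forces concurrence above 1/2 *)

Section Useful.
Context {R : realType}.
Implicit Types (A B U V W : 'M[R[i]]_2) (rho : 'M[R[i]]_(2 * 2))
  (L : @qubit_map R) (a : R).

Lemma std_fidelity_eq0 rho (d : 'rV[R]_3) : corr_mx rho = diag_mx d ->
  std_fidelity rho = 0 -> corr_mx rho = (d 0 0)%:M.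
Proof.
move=> rhoE /eqP; rewrite std_fidelityE rhoE sqrtr_eq0 => le0.
have [e1 e2] : d 0 1 = d 0 0 /\ d 0 2 = d 0 0.
  move: le0; rewrite !mxE /= !mulr1n.
  set x := d 0 0; set y := d 0 1; set z := d 0 2 => le0.
  have := sqr_ge0 (x - y); have := sqr_ge0 (x - z); have := sqr_ge0 (y - z).
  move=> yz xz xy.
  have /eqP : (x - y) ^+ 2 = 0 by lra.
  have /eqP : (x - z) ^+ 2 = 0 by lra.
  by rewrite !sqrf_eq0 !subr_eq0 => /eqP-> /eqP->.
apply/matrixP => i j; rewrite !mxE; congr (_ *+ _).
by move: i {j}; elim/ord3_ind.
Qed.

(** Fixes the sign of the common diagonal entry once the deviation vanishes: a canonical form has at
    most one positive entry. *)
Lemma canonical_diag_le0 (T : 'M[R]_3) d :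
  canonical_diag T d -> exists j, d 0 j <= 0.
Proof.
move=> [s [s0 _]]; case: ifP => _; first by move=> ->; exists 0; rewrite mxE oppr_le0.
move=> [k _ ->]; exists (if k == 0 then 1 else 0); rewrite mxE.
case: (eqVneq k 0) => [->|k0]; first by rewrite /= oppr_le0.
by rewrite eq_sym (negbTE k0) oppr_le0.
Qed.

Lemma max_avg_fidelity_gt rho (x : R) : x < max_avg_fidelity rho ->
  exists U V, [/\ U \is unitarymx, V \is unitarymx &
    x < avg_fidelity (local_conj U V rho)].
Proof.
have u1 := @unitarymx1 R 2.
move=> /sup_gt[|f [U [V [uU uV ->]]] xf]; last by exists U, V.
by exists (avg_fidelity (local_conj 1%:M 1%:M rho)), 1%:M, 1%:M.
Qed.

Lemma useful_shared_state_gt a L : 0 < a < 1 -> unital_channel L ->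
  useful_UQT (shared_state a L) -> 4^-1 < Num.sqrt a * Num.sqrt (1 - a).
Proof.
move=> a01 uL [F23 [rhoC [[U0 [V0 [uU0 uV0 rhoCE]]] [d cd dE]] std0]].
have /andP[a0 a1] := a01.
have tr1 : \tr (shared_state a L) = 1.
  by apply: mxtrace_shared_state1; [rewrite !ltW|case: uL => -[]].
have rhoCtau := std_fidelity_eq0 dE (esym std0).
set tau := d 0 0 in rhoCtau.
have tau0 : tau <= 0.
  have [j dj] := canonical_diag_le0 cd.
  suff -> : tau = d 0 j by [].
  have := congr1 (fun M : 'M[R]_3 => M j j) rhoCtau.
  by rewrite dE !mxE eqxx !mulr1n.
have shE : shared_state a L = local_conj (adjmx U0) (adjmx V0) rhoC.
  by rewrite rhoCE local_conjK.
have [U [V [uU uV]]] := max_avg_fidelity_gt F23.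
(* Local unitaries on the shared state are local unitaries on [rhoC], so the isotropic bound applies
   and gives [tau < - 1/3]. *)
rewrite shE local_conjM => F.
have uU0' := unitarymx_adjmx uU0; have uV0' := unitarymx_adjmx uV0.
have trC : \tr rhoC = 1 by rewrite rhoCE mxtrace_local_conj1.
have := avg_fidelity_local_conj_le (mul_unitarymx uU uU0')
  (mul_unitarymx uV uV0') trC rhoCtau tau0.
move=> /(lt_le_trans F) tau3.
(* Applying [adjmx U0] to both halves of [rhoC] leaves the isotropic correlations unchanged and
   cancels Alice's [U0]; Bob keeps a single unitary, the [W] of the bound. *)
have : corr_mx (local_conj 1%:M (adjmx U0 *m V0) (shared_state a L)) = tau%:M.
  rewrite -(adjmx_unitarymx uU0) -local_conjM -rhoCE.
  exact: corr_mx_local_conj_same.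
move=> /(unital_channel_bound a01 uL (mul_unitarymx uU0' uV0)).
set s := Num.sqrt a * Num.sqrt (1 - a) => bound.
(* With [s <= 1/4] the bound would give [- tau <= (1 - tau) / 4], that is [- tau <= 1/3]. *)
rewrite ltNge; apply/negP => s4.
have : s * (1 - tau) <= 4^-1 * (1 - tau).
  by apply: ler_wpM2r => //; rewrite subr_ge0 (le_trans tau0).
lra.
Qed.

End Useful.

(** * Pauli channels and isotropic useful states *)

Section PauliChannels.
Context {R : realType}.
Implicit Types (A B U V W X : 'M[R[i]]_2) (rho : 'M[R[i]]_(2 * 2))
  (L : @qubit_map R) (a : R).

Definition pauli_channel (p0 : R) (p : 'I_3 -> R) X : 'M[R[i]]_2 :=
  p0%:C *: X + \sum_l (p l)%:C *: (sigma l *m X *m adjmx (sigma l)).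

Lemma pauli_channel_is_linear p0 p : linear (pauli_channel p0 p).
Proof.
move=> c X Y; rewrite /pauli_channel !scalerDr scaler_sumr [RHS]addrACA -big_split /=.
rewrite !scalerA (mulrC c); congr (_ + _); apply: eq_bigr => l _.
by rewrite mulmxDr mulmxDl scalerDr -scalemxAr -scalemxAl !scalerA (mulrC c).
Qed.

HB.instance Definition _ p0 p :=
  GRing.isLinear.Build R[i] 'M[R[i]]_2 'M[R[i]]_2 *:%R (pauli_channel p0 p)
    (pauli_channel_is_linear p0 p).

Lemma id_tensE k (L : 'M[R[i]]_2 -> 'M[R[i]]_2) (X : 'M[R[i]]_(k * 2)) i p j q :
  id_tens L X (mxtens_index (i, p)) (mxtens_index (j, q)) =
  L (\matrix_(r, s) X (mxtens_index (i, r)) (mxtens_index (j, s))) p q.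
Proof.
rewrite /id_tens summxE (bigD1 i) //= summxE (bigD1 j) //= !big1 => [|l li|l lj].
- by rewrite tensmxE delta_mxE !eqxx mul1r !addr0.
- by rewrite summxE big1 // => m _;
  rewrite tensmxE delta_mxE (eq_sym i) (negbTE li) mul0r.
- by rewrite tensmxE delta_mxE (eq_sym j) (negbTE lj) andbF mul0r.
Qed.

Lemma tens1mxE k A (X : 'M[R[i]]_(k * 2)) i p j q :
  ((1%:M *t A) *m X *m adjmx (1%:M *t A)) (mxtens_index (i, p)) (mxtens_index (j, q)) =
  (A *m \matrix_(r, s) X (mxtens_index (i, r)) (mxtens_index (j, s)) *m adjmx A) p q.
Proof.
rewrite mxE sum_mxtens (bigD1 j) //= [X in _ + X]big1 => [|l lj]; last first.
  apply: big1 => s _; rewrite adjmxE tensmxE [1%:M _ _]mxE eq_sym (negbTE lj) mul0r.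
  by rewrite rmorph0 mulr0.
rewrite addr0 [RHS]mxE; apply: eq_bigr => s _.
rewrite !adjmxE tensmxE [1%:M _ _]mxE eqxx mul1r; congr (_ * _).
rewrite mxE sum_mxtens (bigD1 i) //= [X in _ + X]big1 => [|l li]; last first.
  by apply: big1 => r _; rewrite tensmxE [1%:M _ _]mxE eq_sym (negbTE li) !mul0r.
rewrite addr0 [RHS]mxE; apply: eq_bigr => r _.
by rewrite tensmxE [1%:M _ _]mxE eqxx mul1r [in RHS]mxE.
Qed.

Lemma psdmxD n (X Y : 'M[R[i]]_n) : psdmx X -> psdmx Y -> psdmx (X + Y).
Proof.
move=> pX pY v; rewrite mulmxDr mulmxDl mxE.
exact: addr_ge0 (pX v) (pY v).
Qed.

Lemma psdmxZ n (c : R) (X : 'M[R[i]]_n) : 0 <= c -> psdmx X -> psdmx (c%:C *: X).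
Proof.
move=> c0 pX v; rewrite -scalemxAr -scalemxAl mxE.
by apply: mulr_ge0 (pX v); rewrite ler0c.
Qed.

(** Tensoring with the identity gives a Kraus sum again, with operators [1%:M *t sigma l], and each
    conjugation preserves positivity. *)
Lemma pauli_channel_cp p0 p : 0 <= p0 -> (forall l, 0 <= p l) ->
  completely_positive (pauli_channel p0 p).
Proof.
move=> p00 p_ge0 k X pX.
have -> : id_tens (pauli_channel p0 p) X = p0%:C *: X + \sum_l (p l)%:C *:
    ((1%:M *t sigma l) *m X *m adjmx (1%:M *t sigma l)).
  apply/matrixP => u v; case: (mxtens_indexP u) (mxtens_indexP v) => i r [j s].
  rewrite id_tensE /pauli_channel [LHS]mxE [RHS]mxE; congr (_ + _).
    by rewrite !mxE.
  by rewrite !summxE; apply: eq_bigr => l _; rewrite [LHS]mxE [RHS]mxE tens1mxE.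
apply: psdmxD; first exact: psdmxZ.
elim/big_ind : _ => [|Y Z pY pZ|l _].
- by move=> v; rewrite mulmx0 mul0mx mxE.
- exact: psdmxD.
- by apply: psdmxZ => //; exact: psdmx_conj.
Qed.

Lemma adjmx_sigma l : adjmx (sigma l) = sigma l :> 'M[R[i]]_2.
Proof. by have [] := @traceless_herm_sigma R l. Qed.

Lemma sigma_sqr l : sigma l *m sigma l = 1%:M :> 'M[R[i]]_2.
Proof.
apply/matrixP => i j; rewrite mxE sum_ord2 [RHS]mxE; move: i j l.
by do 2 elim/ord2_ind; elim/ord3_ind; rewrite /= !pauliE !mx2E;
  apply: complex_ext => /=; ring.
Qed.

Lemma sigma_anticomm k l : k != l ->
  sigma k *m sigma l = - (sigma l *m sigma k) :> 'M[R[i]]_2.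
Proof.
move=> kl; apply/matrixP => i j; rewrite [RHS]mxE !mxE !sum_ord2; move: i j k l kl.
by do 2 elim/ord2_ind; do 2 elim/ord3_ind; move=> //= _; rewrite !pauliE !mx2E;
  apply: complex_ext => /=; ring.
Qed.

Lemma sigma_conj k l : sigma k *m sigma l *m sigma k =
  (if k == l then sigma l else - sigma l) :> 'M[R[i]]_2.
Proof.
case: eqVneq => [->|/sigma_anticomm->]; first by rewrite sigma_sqr mul1mx.
by rewrite mulNmx -mulmxA sigma_sqr mulmx1.
Qed.

Lemma pauli_channel_unital p0 p : 0 <= p0 -> (forall l, 0 <= p l) ->
  p0 + \sum_l p l = 1 -> unital_channel (pauli_channel p0 p).
Proof.
move=> p00 p_ge0 p1; have pC : p0%:C + \sum_l (p l)%:C = 1 :> R[i].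
  by rewrite -rmorph_sum -rmorphD p1.
split; first split; first exact: pauli_channel_cp.
  move=> X; rewrite /pauli_channel mxtraceD mxtraceZ (raddf_sum mxtrace) /=.
  under eq_bigr do rewrite mxtraceZ mxtrace_mulC mulmxA adjmx_sigma sigma_sqr mul1mx.
  by rewrite -mulr_suml -mulrDl pC mul1r.
rewrite /= /pauli_channel; under eq_bigr do rewrite mulmx1 adjmx_sigma sigma_sqr.
by rewrite -scaler_suml -scalerDl pC scale1r.
Qed.

(** Each [sigma l] is an eigenvector in the Heisenberg picture; the minus signs come from the
    [sigma k] that anticommute with it. *)
Lemma mxtrace_pauli_channel p0 p X l :
  \tr (pauli_channel p0 p X *m sigma l) =
  (p0 + \sum_k (if k == l then p k else - p k))%:C * \tr (X *m sigma l).
Proof.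
rewrite /pauli_channel mulmxDl mulmx_suml mxtraceD (raddf_sum mxtrace) rmorphD.
rewrite -scalemxAl mxtraceZ mulrDl rmorph_sum mulr_suml; congr (_ + _).
apply: eq_bigr => k _ /=; rewrite -scalemxAl mxtraceZ adjmx_sigma.
rewrite -!mulmxA mxtrace_mulC -!mulmxA (mulmxA (sigma k)) sigma_conj.
by case: eqP => // _; rewrite mulmxN (raddfN mxtrace) rmorphN mulrN mulNr.
Qed.

(** The correlation matrix of [Psi a] is [diag(c, -c, 1)], and the channel multiplies its columns by
    the eigenvalues [m l]. *)
Lemma corr_mx_pauli_channel a p0 p : 0 <= a <= 1 ->
  let m l := p0 + \sum_k (if k == l then p k else - p k) in
  let c := 2 * (Num.sqrt a * Num.sqrt (1 - a)) in
  corr_mx (shared_state a (pauli_channel p0 p)) =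
  diag_mx (\row_l ([:: c * m 0; - c * m 1; m 2]`_l)).
Proof.
move=> /andP[a0 a1] m c; apply/matrixP => k l.
rewrite corr_mxE -[shared_state _ _]local_conj1 mxtrace_shared_state.
transitivity (complex.Re ((m l)%:C * \sum_i \sum_p (amplitude a i * amplitude a p)%:C *
    (sigma k p i * sigma l p i))).
  congr complex.Re; rewrite mulr_sumr; apply: eq_bigr => i _.
  rewrite mulr_sumr; apply: eq_bigr => q _.
  rewrite mul1mx adjmx1 mulmx1 mxtrace_pauli_channel mxtrace_mulC tr_mul_delta -/(m l).
  by rewrite [RHS]mulrCA; congr (_ * _); rewrite [RHS]mulrCA.
rewrite Re_scale !sum_ord2 /amplitude /=.
set x := Num.sqrt a; set y := Num.sqrt (1 - a).
have xx : x * x = a by rewrite -expr2 sqr_sqrtr.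
have yy : y * y = 1 - a by rewrite -expr2 sqr_sqrtr ?subr_ge0.
rewrite !mxE -/x -/y xx yy (mulrC y x) -/(m 0).
move: k l; do 2 elim/ord3_ind; rewrite /= !pauliE !mx2E /= /c -/x -/y;
  move: (m 0) (m 1) (m 2) => m0 m1 m2; ring.
Qed.

(** Such a state is its own canonical form: the singular values all equal [- tau] and the
    determinant [tau^3] is negative, so every sign is -1. *)
Lemma useful_UQT_isotropic rho tau : \tr rho = 1 -> corr_mx rho = tau%:M ->
  tau < - 3^-1 -> useful_UQT rho.
Proof.
move=> tr1 rhoE tau3; have tau0 : tau <= 0 by lra.
have u1 := @unitarymx1 R 2.
split.
  have avgE : avg_fidelity rho = (1 - tau) / 2.
    by rewrite avg_fidelityE tr1 rhoE mxtrace_scalar /=; field.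
  apply: (@lt_le_trans _ _ (avg_fidelity rho)); first by rewrite avgE; lra.
  apply: ub_le_sup; last by exists 1%:M, 1%:M; rewrite local_conj1.
  exists ((1 - tau) / 2) => _ [U [V [uU uV ->]]].
  exact: avg_fidelity_local_conj_le.
exists rho; last first.
  rewrite std_fidelityE rhoE !mxE /= !mulr1n subrr expr0n /= !addr0 mul0r.
  by rewrite sqrtr0.
split; first by exists 1%:M, 1%:M; rewrite local_conj1.
exists (const_mx tau); last first.
  by rewrite rhoE; apply/matrixP => i j; rewrite !mxE.
exists (const_mx (- tau)).
  split; first by move=> k; rewrite mxE oppr_ge0.
  rewrite rhoE tr_scalar_mx -scalar_mxM.
  have -> (c : R) : char_poly (c%:M : 'M[R]_3) = ('X - c%:P) ^+ 3.
    rewrite /char_poly (_ : char_poly_mx _ = ('X - c%:P)%:M) ?det_scalar//.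
    by rewrite /char_poly_mx map_scalar_mx raddfB.
  under eq_bigr do rewrite mxE sqrrN.
  by rewrite prodr_const card_ord expr2.
rewrite rhoE det_scalar ifT.
  by apply/matrixP => i j; rewrite !mxE opprK.
by rewrite exprSr expr2 mulr_ge0_le0// -expr2 sqr_ge0.
Qed.

Lemma concurrence_Psi a : concurrence (Psi a) = 2 * (Num.sqrt a * Num.sqrt (1 - a)).
Proof.
rewrite /concurrence.
(* [sigma 1 *t sigma 1] exchanges the kets 00 and 11 with the sign -1. *)
have -> : (adjmx (Psi a) *m (sigma 1 *t sigma 1) *m map_mx Num.conj (Psi a)) 0 0 =
    (- (2 * (Num.sqrt a * Num.sqrt (1 - a))))%:C.
  have conj_Psi i j : conjc (Psi a (mxtens_index (i, j)) 0) =
      (amplitude a i)%:C * (i == j)%:R.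
    by rewrite PsiE; case: (i == j); simpc.
  rewrite mxE sum_mxtens; under eq_bigr => i _ do under eq_bigr => j _ do
    (rewrite mxE sum_mxtens [map_mx _ _ _ _]mxE [Num.conj _]conj_Psi;
     under eq_bigr => p _ do under eq_bigr => q _ do rewrite adjmxE conj_Psi tensmxE).
  rewrite !sum_ord2 !pauliE !mx2E /amplitude; apply: complex_ext => /=; ring.
rewrite normc_def /= expr0n addr0 sqrtr_sqr normrN ger0_norm//.
Qed.

End PauliChannels.

(** * Both directions of the equivalence, and strictness of the inclusion *)

Theorem proposition8 (R : realType) (a : R) (ha : 2^-1 < a < 1) :
  [/\ concurrence (Psi a) = 2 * Num.sqrt (a * (1 - a)),
      0 < concurrence (Psi a) < 1,
      (useful_channels a !=set0 /\ useful_channels a `<` unital_channels R) <->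
        2^-1 < concurrence (Psi a) < 1
    & concurrence (Psi a) <= 2^-1 -> useful_channels a = set0].
Proof.
have /andP[a2 a1] := ha; have a0 : 0 < a by lra.
have a01 : 0 < a < 1 by rewrite a0.
have a01' : 0 <= a <= 1 by rewrite !ltW.
have CE := concurrence_Psi a; set C := concurrence _ in CE *.
set x := Num.sqrt a in CE; set y := Num.sqrt (1 - a) in CE.
have xx : x ^+ 2 = a by rewrite sqr_sqrtr// ltW.
have yy : y ^+ 2 = 1 - a by rewrite sqr_sqrtr// subr_ge0 ltW.
have C01 : 0 < C < 1.
  rewrite CE !mulr_gt0 ?sqrtr_gt0 ?subr_gt0//=.
  (* The amplitudes differ because [a] exceeds 1/2, and [(x - y) ^+ 2 > 0] is [C < 1]. *)
  have xy : x != y by apply/eqP => xy; move: yy; rewrite -xy xx; lra.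
  have : 0 < (x - y) ^+ 2 by rewrite exprn_even_gt0//= subr_eq0.
  by rewrite sqrrB xx yy; lra.
have only_if : useful_channels a !=set0 -> 2^-1 < C.
  move=> [L [uL useL]]; have := useful_shared_state_gt a01 uL useL.
  by rewrite CE -/x -/y; lra.
split=> //.
- by rewrite CE sqrtrM// ltW.
- split=> [[/only_if C2 _]|/andP[C2 C1]]; first by rewrite C2; case/andP: C01.
  have tr1 p0 p : unital_channel (pauli_channel p0 p) ->
      \tr (shared_state a (pauli_channel p0 p)) = 1.
    by move=> [[_ tp] _]; exact: mxtrace_shared_state1.
  split.
    (* With no [sigma 0] term, these are the only weights of sum 1 that make [C * m 0], [- C * m 1]
       and [m 2] equal: [q] for the identity and [sigma 2], [(2 - C)^-1] for [sigma 1]. The common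
       value is [- C / (2 - C)]. *)
    pose q := (1 - C) / (2 * (2 - C)); pose p (l : 'I_3) := [:: 0; (2 - C)^-1; q]`_l.
    have C20 : 2 - C != 0 by rewrite gt_eqF// subr_gt0 (lt_trans C1)// ltr1n.
    have q0 : 0 <= q.
      by rewrite divr_ge0 ?subr_ge0 ?mulr_ge0 ?subr_ge0 ?ltW// (lt_trans C1)// ltr1n.
    have uL : unital_channel (pauli_channel q p).
      apply: pauli_channel_unital => //.
        elim/ord3_ind; rewrite /p //=.
        by rewrite invr_ge0 subr_ge0 ltW// (lt_trans C1)// ltr1n.
      by rewrite sum_ord3 /p /= /q; field.
    exists (pauli_channel q p); split=> //.
    apply: (@useful_UQT_isotropic _ _ (- (C / (2 - C)))); first exact: tr1.
      rewrite corr_mx_pauli_channel// -/x -/y -CE; apply/matrixP => i j; rewrite !mxE.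
      congr (_ *+ _); move: i {j}; elim/ord3_ind;
        rewrite /= !sum_ord3 /p /= /q; field=> //.
    (* [C / (2 - C) > 1/3] amounts to [C > 1/2]. *)
    rewrite ltrN2 ltr_pdivlMr ?subr_gt0 ?(lt_trans C1) ?ltr1n//; lra.
  split; first by move=> L [].
  (* The completely depolarizing channel erases all correlations, so the fidelity never exceeds 1/2;
     it witnesses strictness. *)
  have uL : unital_channel (pauli_channel (4^-1 : R) (fun=> 4^-1)).
    by apply: pauli_channel_unital => //; rewrite sum_ord3; field.
  move=> /(_ (pauli_channel (4^-1 : R) (fun=> 4^-1)) uL) [_ [F23 _]].
  have [U [V [uU uV]]] := max_avg_fidelity_gt F23.
  have : corr_mx (shared_state a (pauli_channel (4^-1 : R) (fun=> 4^-1))) = 0%:M.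
    rewrite corr_mx_pauli_channel//; apply/matrixP => i j; rewrite !mxE.
    by congr (_ *+ _); move: i {j}; elim/ord3_ind; rewrite /= !sum_ord3 /=; field.
  move=> /(avg_fidelity_local_conj_le uU uV (tr1 _ _ uL)) /(_ (lexx 0)); lra.
- move=> C2; apply/eqP; rewrite -[_ == _]negbK; apply/negP => /set0P /only_if.
  by rewrite ltNge C2.
Qed.
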